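(* The motion of the cylindrical Veselova top on the reduced space $\mathcal{R}$ has the following properties. (i) It is integrable, with the 3 first integrals $P$, $H$ and $F:=2(J_1+J_2)AH+B$. (ii) Each point with $H=0$ is an equilibrium. (iii) For each $(h,P)$ with $h>0$ such that $(P,h)$ is in the image of the energy-momentum map $(P,H)$, there is a unique equilibrium with $H=h$ (and that value of $P$); it occurs at the point $(A,B,P,D)=(A_0,B_0,P,0)$, where $$A_0=\frac{P-4J_2h}{4(J_1-J_2)h},\qquad B_0=\frac{(P-4J_2h)(P+4J_1h)}{8(J_1-J_2)h}.$$ (iv) All other solutions are periodic with period $\pi\sqrt{\frac{J_1+J_2}{2h}}$, where $h$ is the value of $H$ along the solution.
   Context: Let $J_1,J_2>0$, $J_1\ne J_2$ (eigenvalues of the mass tensor $\mathbb{J}=\mathrm{diag}[J_1,\dots,J_1,J_2,\dots,J_2]$ of the cylindrical Veselova top, with multiplicities $r,r'\ge2$). The reduced space is $$\mathcal{R}=\{(A,B,P,D)\in\mathbb{R}^4:0\le A\le1,\ 0\le B\le P,\ D^2\le AB,\ D^2\le(1-A)(P-B)\},$$ and the reduced dynamics on $\mathcal{R}$ is $$\dot A=\frac{2D}{J_1+J_2},\quad \dot B=-4HD,\quad \dot P=0,\quad \dot D=-4HA+\frac{P-4J_2H}{J_1-J_2},$$ $$H=\frac12\left((\beta_1-\beta_2)B+\beta_2P-\frac{(\beta_1-\beta_2)^2D^2}{\beta_1A+\beta_2(1-A)}\right),$$ $$\beta_1=((J_1-J_2)A+J_1+J_2)^{-1},\quad \beta_2=((J_1-J_2)A+2J_2)^{-1}.$$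 The energy-momentum map is $(P,H)$; its image is the set of values taken by $(P,H)$ on $\mathcal{R}$. *)

(* Defs.v *)
From Stdlib Require Import Reals.
From Coquelicot Require Import Coquelicot.
Open Scope R_scope.

(** * Vector fields on a subset of a normed space *)

Section Dynamics.

Context {V : NormedModule R_AbsRing}.

Definition in_interval (a b : Rbar) (t : R) : Prop :=
  Rbar_lt a t /\ Rbar_lt t b.

(* An integral curve of [X] over the open interval (a, b) that stays in [K].
   The values of [gamma] outside (a, b) are irrelevant. *)
Definition solution (X : V -> V) (K : V -> Prop) (a b : Rbar) (gamma : R -> V)
  : Prop :=
  forall t, in_interval a b t ->
    K (gamma t) /\ is_derive gamma t (X (gamma t)).

Definition equilibrium (X : V -> V) (K : V -> Prop) (x : V) : Prop :=
  K x /\ X x = zero.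

Definition first_integral (X : V -> V) (K : V -> Prop) (f : V -> R) : Prop :=
  forall (a b : Rbar) (gamma : R -> V), solution X K a b gamma ->
    forall s t, in_interval a b s -> in_interval a b t ->
      f (gamma s) = f (gamma t).

Definition independent_at (f1 f2 f3 : V -> R) (x : V) : Prop :=
  exists d1 d2 d3 : V -> R,
    filterdiff f1 (locally x) d1 /\
    filterdiff f2 (locally x) d2 /\
    filterdiff f3 (locally x) d3 /\
    forall c1 c2 c3 : R,
      (forall v, c1 * d1 v + c2 * d2 v + c3 * d3 v = 0) ->
      c1 = 0 /\ c2 = 0 /\ c3 = 0.

Definition dense_in (K U : V -> Prop) : Prop :=
  forall x, K x -> forall N : V -> Prop, locally x N ->
    exists y, K y /\ U y /\ N y.

Definition functionally_independent (K : V -> Prop) (f1 f2 f3 : V -> R)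
  : Prop :=
  exists U : V -> Prop, open U /\ dense_in K U /\
    forall x, K x -> U x -> independent_at f1 f2 f3 x.

(* Integrability of a vector field in dimension 4 by dim - 1 = 3 independent
   first integrals: their generic common level sets are curves. *)
Definition integrable_with (X : V -> V) (K : V -> Prop) (f1 f2 f3 : V -> R)
  : Prop :=
  first_integral X K f1 /\ first_integral X K f2 /\ first_integral X K f3 /\
  functionally_independent K f1 f2 f3.

Definition is_period (gamma : R -> V) (T : R) : Prop :=
  0 < T /\ forall t, gamma (t + T) = gamma t.

Definition periodic_with_period (gamma : R -> V) (T : R) : Prop :=
  is_period gamma T /\ forall S, is_period gamma S -> T <= S.

End Dynamics.

(** * The reduced cylindrical Veselova top *)

(* R^4 with coordinates (A, B, P, D). *)
Definition phase : NormedModule R_AbsRing :=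
  prod_NormedModule R_AbsRing
    (prod_NormedModule R_AbsRing
      (prod_NormedModule R_AbsRing R_NormedModule R_NormedModule)
      R_NormedModule)
    R_NormedModule.

Definition point (A B P D : R) : phase := (A, B, P, D).

Definition reduced_space (x : phase) : Prop :=
  let '(A, B, P, D) := x in
  0 <= A <= 1 /\ 0 <= B <= P /\
  D ^ 2 <= A * B /\ D ^ 2 <= (1 - A) * (P - B).

Definition beta1 (J1 J2 A : R) : R := / ((J1 - J2) * A + J1 + J2).

Definition beta2 (J1 J2 A : R) : R := / ((J1 - J2) * A + 2 * J2).

Definition energy (J1 J2 : R) (x : phase) : R :=
  let '(A, B, P, D) := x in
  let b1 := beta1 J1 J2 A in
  let b2 := beta2 J1 J2 A in
  1 / 2 * ((b1 - b2) * B + b2 * P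
           - (b1 - b2) ^ 2 * D ^ 2 / (b1 * A + b2 * (1 - A))).

Definition momentum (x : phase) : R :=
  let '(A, B, P, D) := x in P.

Definition third_integral (J1 J2 : R) (x : phase) : R :=
  let '(A, B, P, D) := x in
  2 * (J1 + J2) * A * energy J1 J2 x + B.

Definition veselova_field (J1 J2 : R) (x : phase) : phase :=
  let '(A, B, P, D) := x in
  let H := energy J1 J2 x in
  point (2 * D / (J1 + J2))
        (- 4 * H * D)
        0
        (- 4 * H * A + (P - 4 * J2 * H) / (J1 - J2)).

Definition energy_momentum_image (J1 J2 P h : R) : Prop :=
  exists x, reduced_space x /\ momentum x = P /\ energy J1 J2 x = h.

(* Main.v *)
Require Import Defs.
From Stdlib Require Import Reals Lra Psatz.
From Coquelicot Require Import Coquelicot.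
Open Scope R_scope.

(** Write S = J1 + J2, a = J1 - J2 and w1 = 1 / beta1, w2 = 1 / beta2. Both
    w1 and w2 are positive on the reduced space, and beta1 A + beta2 (1 - A)
    = S beta1 beta2, so that H is a rational function: 2 H w1 w2 = P w1 - a
    B - a^2 D^2 / S. All claims come from clearing the denominators in this
    formula.

    Rewriting 2 S w1 w2 H as a sum of four terms that are nonnegative on the
    reduced space ([energy_weighted_sum]) gives H >= 0, and H = 0 only if B
    = P = D = 0, where the field vanishes.

    Now fix P, H = h > 0 and F = f. Then B = f - 2 S h A, and the equation H
    = h becomes an ellipse D^2 + 2 h S (A - A0)^2 = const in the (A, D)
    plane ([energy_eq_on_ellipse]). On this ellipse the two functions A B -
    D^2 and (1 - A)(P - B) - D^2, which cut out the reduced space, are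
    constant multiples of w1 and w2 respectively ([on_ellipse_slack]). One
    point in the reduced space makes these constants nonnegative; they then
    confine the whole ellipse to 0 <= A <= 1, where w1 and w2 are positive,
    so that both functions stay nonnegative. Hence the ellipse lies in the
    reduced space as soon as one of its points does ([level_set_iff]). The
    equilibrium is the ellipse shrunk to its centre.

    H is conserved, as differentiating the cleared equation shows
    ([rational_energy_conserved]), and then so is F. Along a solution the
    equations for A and D are therefore linear with constant coefficients,
    A' = 2 D / S and D' = - 4 h (A - A0): a rotation of the ellipse with
    angular speed sqrt (8 h / S), whose period is PI sqrt (S / (2 h)). The
    explicit rotation ([orbit]) stays in the reduced space, as just shown
    for the whole ellipse, and any solution coincides with it because the
    quadratic form D^2 + 2 S h A^2 of the difference of two solutions is
    conserved ([linear_system_unique]).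

    The integrals are independent at the points of the reduced space with D
    <> 0: there dH has a nonzero dD component, while dP and dF - 2 S A dH
    have none. Such points are dense, because the reduced space is convex
    and has interior points on both sides of D = 0. *)

(** * Curves and functions on the phase space *)

Definition coord_A (x : phase) : R := fst (fst (fst x)).
Definition coord_B (x : phase) : R := snd (fst (fst x)).
Definition coord_P (x : phase) : R := snd (fst x).
Definition coord_D (x : phase) : R := snd x.

Lemma is_derive_pair {U V : NormedModule R_AbsRing} (f : R -> U) (g : R -> V)
    (t : R) (u : U) (v : V) :
  is_derive f t u -> is_derive g t v ->
  is_derive (fun s => (f s, g s) : prod_NormedModule R_AbsRing U V) t (u, v).
Proof.
  intros Hf Hg.
  apply (filterdiff_comp'_2 f g (fun a b => (a, b)) t _ _ (fun a b => (a, b)) Hf Hg).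
  apply (filterdiff_ext_lin _ (fun y => y)).
  - apply (filterdiff_ext (fun y => y)); [now intros [] | apply filterdiff_id].
  - now intros [].
Qed.

Lemma is_derive_fst {U V : NormedModule R_AbsRing}
    (c : R -> prod_NormedModule R_AbsRing U V) (t : R) (v : U * V) :
  is_derive c t v -> is_derive (fun s => fst (c s)) t (fst v).
Proof.
  intros Hc.
  apply (filterdiff_comp' c fst t _ fst Hc (filterdiff_linear _ is_linear_fst)).
Qed.

Lemma is_derive_snd {U V : NormedModule R_AbsRing}
    (c : R -> prod_NormedModule R_AbsRing U V) (t : R) (v : U * V) :
  is_derive c t v -> is_derive (fun s => snd (c s)) t (snd v).
Proof.
  intros Hc.
  apply (filterdiff_comp' c snd t _ snd Hc (filterdiff_linear _ is_linear_snd)).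
Qed.

Lemma is_derive_point (A B P D : R -> R) (t dA dB dP dD : R) :
  is_derive A t dA -> is_derive B t dB -> is_derive P t dP ->
  is_derive D t dD ->
  is_derive (fun s => point (A s) (B s) (P s) (D s)) t (point dA dB dP dD).
Proof.
  intros HA HB HP HD.
  exact (is_derive_pair _ _ _ _ _
    (is_derive_pair _ _ _ _ _ (is_derive_pair _ _ _ _ _ HA HB) HP) HD).
Qed.

Lemma is_derive_coords (c : R -> phase) (t dA dB dP dD : R) :
  is_derive c t (point dA dB dP dD) ->
  is_derive (fun s => coord_A (c s)) t dA /\
  is_derive (fun s => coord_B (c s)) t dB /\
  is_derive (fun s => coord_P (c s)) t dP /\
  is_derive (fun s => coord_D (c s)) t dD.
Proof.
  intros Hc.
  pose proof (is_derive_fst _ _ _ Hc) as H1.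
  pose proof (is_derive_fst _ _ _ H1) as H2.
  split; [|split; [|split]].
  - exact (is_derive_fst _ _ _ H2).
  - exact (is_derive_snd _ _ _ H2).
  - exact (is_derive_snd _ _ _ H1).
  - exact (is_derive_snd _ _ _ Hc).
Qed.

Lemma in_interval_between (a b : Rbar) (s t u : R) :
  in_interval a b s -> in_interval a b t -> s <= u <= t -> in_interval a b u.
Proof.
  intros [Has _] [_ Htb] [Hsu Hut]; split.
  - exact (Rbar_lt_le_trans a s u Has Hsu).
  - exact (Rbar_le_lt_trans u t b Hut Htb).
Qed.

(** Stated with endpoints in [Rbar], so that it serves solutions on bounded
    and unbounded intervals alike. *)
Lemma derive_zero_constant (a b : Rbar) (f : R -> R) :
  (forall t, in_interval a b t -> is_derive f t 0) ->
  forall s t, in_interval a b s -> in_interval a b t -> f s = f t.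
Proof.
  intros Hf.
  assert (Hlt : forall s t, in_interval a b s -> in_interval a b t ->
                  s < t -> f s = f t).
  { intros s t Hs Ht Hst. apply eq_is_derive; [|exact Hst].
    intros u Hu. apply Hf. now apply (in_interval_between a b s t u). }
  intros s t Hs Ht. destruct (Rtotal_order s t) as [H|[H|H]].
  - now apply Hlt.
  - now rewrite H.
  - symmetry. now apply Hlt.
Qed.

Lemma filterdiff_Rplus (f g lf lg : phase -> R) (x : phase) :
  filterdiff f (locally x) lf -> filterdiff g (locally x) lg ->
  filterdiff (fun y => f y + g y) (locally x) (fun v => lf v + lg v).
Proof. intros Hf Hg. exact (filterdiff_plus_fct f g lf lg Hf Hg). Qed.

Lemma filterdiff_Rmult (f g lf lg : phase -> R) (x : phase) :
  filterdiff f (locally x) lf -> filterdiff g (locally x) lg ->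
  filterdiff (fun y => f y * g y) (locally x)
    (fun v => lf v * g x + f x * lg v).
Proof.
  intros Hf Hg. exact (filterdiff_mult_fct f g x lf lg Rmult_comm Hf Hg).
Qed.

Lemma filterdiff_Rinv (f lf : phase -> R) (x : phase) :
  f x <> 0 -> filterdiff f (locally x) lf ->
  filterdiff (fun y => / f y) (locally x) (fun v => lf v * (- / f x ^ 2)).
Proof.
  intros Hx Hf.
  apply (filterdiff_comp' f Rinv x lf (fun y => scal y (- / f x ^ 2)) Hf).
  change (is_derive Rinv (f x) (- / f x ^ 2)).
  auto_derive; [exact Hx | field; exact Hx].
Qed.

Lemma filterdiff_Rconst (c : R) (x : phase) :
  filterdiff (fun _ => c) (locally x) (fun _ => 0).
Proof. apply (filterdiff_const (V := R_NormedModule) c). Qed.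

Lemma filterdiff_coords (x : phase) :
  filterdiff coord_A (locally x) coord_A /\
  filterdiff coord_B (locally x) coord_B /\
  filterdiff coord_P (locally x) coord_P /\
  filterdiff coord_D (locally x) coord_D.
Proof.
  assert (H3 : is_linear (fun y : phase => fst (fst y))).
  { apply (is_linear_comp fst fst); apply is_linear_fst. }
  split; [|split; [|split]]; apply filterdiff_linear.
  - apply (is_linear_comp (fun y : phase => fst (fst y)) fst H3).
    apply is_linear_fst.
  - apply (is_linear_comp (fun y : phase => fst (fst y)) snd H3).
    apply is_linear_snd.
  - apply (is_linear_comp (U := phase) fst snd).
    + apply is_linear_fst.
    + apply is_linear_snd.
  - apply is_linear_snd.
Qed.

(** * The closed form of the energy *)

(** The inverses of [beta1] and [beta2]; they are affine in A, which makes the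
    positivity on the reduced space visible. *)
Definition weight1 (J1 J2 A : R) : R := (J1 - J2) * A + J1 + J2.
Definition weight2 (J1 J2 A : R) : R := (J1 - J2) * A + 2 * J2.

Lemma weights_pos (J1 J2 A : R) :
  0 < J1 -> 0 < J2 -> 0 <= A <= 1 ->
  0 < weight1 J1 J2 A /\ 0 < weight2 J1 J2 A.
Proof. unfold weight1, weight2; intros; split; nra. Qed.

Definition rational_energy (J1 J2 A B P D : R) : R :=
  (P * weight1 J1 J2 A - (J1 - J2) * B - (J1 - J2) ^ 2 * D ^ 2 / (J1 + J2))
  / (2 * weight1 J1 J2 A * weight2 J1 J2 A).

(** The denominator beta1 A + beta2 (1 - A) in H collapses to S beta1 beta2,
    because the quadratic terms in A w2 + (1 - A) w1 cancel. *)
Lemma energy_closed_form (J1 J2 A B P D : R) :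
  0 < J1 + J2 -> weight1 J1 J2 A <> 0 -> weight2 J1 J2 A <> 0 ->
  energy J1 J2 (point A B P D) = rational_energy J1 J2 A B P D.
Proof.
  unfold rational_energy, weight1, weight2; intros HS H1 H2.
  unfold energy, point, beta1, beta2.
  assert (Hk : / ((J1 - J2) * A + J1 + J2) * A
             + / ((J1 - J2) * A + 2 * J2) * (1 - A)
             = (J1 + J2) / (((J1 - J2) * A + J1 + J2)
                            * ((J1 - J2) * A + 2 * J2))).
  { field. now split. }
  rewrite Hk. field. repeat split; try assumption; lra.
Qed.

Lemma energy_eq_iff (J1 J2 A B P D h : R) :
  0 < J1 + J2 -> weight1 J1 J2 A <> 0 -> weight2 J1 J2 A <> 0 ->
  energy J1 J2 (point A B P D) = h <->
  (J1 + J2) * (2 * h * weight1 J1 J2 A * weight2 J1 J2 A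
    + (J1 - J2) * B - P * weight1 J1 J2 A) + (J1 - J2) ^ 2 * D ^ 2 = 0.
Proof.
  intros HS H1 H2. rewrite energy_closed_form by assumption. unfold rational_energy. split.
  - intros <-. field. repeat split; try assumption; lra.
  - intros E.
    apply (Rmult_eq_reg_r ((J1 + J2) * (2 * weight1 J1 J2 A * weight2 J1 J2 A))).
    + field_simplify; [lra | repeat split; try assumption; lra].
    + repeat apply Rmult_integral_contrapositive_currified; try assumption; lra.
Qed.

(** From a^2 = S^2 - 4 J1 J2, w2 = S A + 2 J2 (1 - A) and the closed form;
    every summand on the right is nonnegative on the reduced space. *)
Lemma energy_weighted_sum (J1 J2 A B P D : R) :
  0 < J1 + J2 -> weight1 J1 J2 A <> 0 -> weight2 J1 J2 A <> 0 ->
  2 * (J1 + J2) * weight1 J1 J2 A * weight2 J1 J2 A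
    * energy J1 J2 (point A B P D) =
  (J1 + J2) ^ 2 * (A * B - D ^ 2) + 4 * J1 * J2 * D ^ 2
  + 2 * J2 * (J1 + J2) * ((1 - A) * B)
  + (J1 + J2) * (weight1 J1 J2 A * (P - B)).
Proof.
  intros HS H1 H2. rewrite energy_closed_form by assumption.
  revert H1 H2. unfold rational_energy, weight1, weight2. intros H1 H2. field.
  repeat split; try assumption; lra.
Qed.

Lemma energy_summands_nonneg (J1 J2 A B P D : R) :
  0 < J1 -> 0 < J2 -> reduced_space (point A B P D) ->
  0 <= (J1 + J2) ^ 2 * (A * B - D ^ 2) /\
  0 <= 4 * J1 * J2 * D ^ 2 /\
  0 <= 2 * J2 * (J1 + J2) * ((1 - A) * B) /\
  0 <= (J1 + J2) * (weight1 J1 J2 A * (P - B)).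
Proof.
  intros HJ1 HJ2 (HA & HB & H1 & H2).
  destruct (weights_pos J1 J2 A HJ1 HJ2 HA) as [W1 W2].
  assert (HJJ : 0 < J1 * J2) by now apply Rmult_lt_0_compat.
  assert (HJS : 0 < J2 * (J1 + J2)) by (apply Rmult_lt_0_compat; lra).
  split; [|split; [|split]].
  - apply Rmult_le_pos; [apply pow2_ge_0 | lra].
  - apply Rmult_le_pos; [lra | apply pow2_ge_0].
  - apply Rmult_le_pos; [lra | apply Rmult_le_pos; lra].
  - apply Rmult_le_pos; [lra | apply Rmult_le_pos; lra].
Qed.

Lemma energy_nonneg (J1 J2 : R) (x : phase) :
  0 < J1 -> 0 < J2 -> reduced_space x -> 0 <= energy J1 J2 x.
Proof.
  destruct x as [[[A B] P] D]. intros HJ1 HJ2 HR.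
  destruct (energy_summands_nonneg J1 J2 A B P D HJ1 HJ2 HR)
    as (T1 & T2 & T3 & T4).
  destruct HR as (HA & _).
  destruct (weights_pos J1 J2 A HJ1 HJ2 HA) as [W1 W2].
  assert (HS : 0 < J1 + J2) by lra.
  pose proof (energy_weighted_sum J1 J2 A B P D HS
    (Rgt_not_eq _ _ W1) (Rgt_not_eq _ _ W2)) as E.
  assert (Hw : 0 < 2 * (J1 + J2) * weight1 J1 J2 A * weight2 J1 J2 A)
    by (repeat (apply Rmult_lt_0_compat; try lra)).
  change (0 <= energy J1 J2 (point A B P D)).
  apply (Rmult_le_reg_l _ _ _ Hw). rewrite E. lra.
Qed.

Lemma energy_zero (J1 J2 A B P D : R) :
  0 < J1 -> 0 < J2 -> reduced_space (point A B P D) ->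
  energy J1 J2 (point A B P D) = 0 -> B = 0 /\ P = 0 /\ D = 0.
Proof.
  intros HJ1 HJ2 HR E0.
  destruct (energy_summands_nonneg J1 J2 A B P D HJ1 HJ2 HR)
    as (T1 & T2 & T3 & T4).
  destruct HR as (HA & HB & _).
  destruct (weights_pos J1 J2 A HJ1 HJ2 HA) as [W1 W2].
  assert (HS : 0 < J1 + J2) by lra.
  pose proof (energy_weighted_sum J1 J2 A B P D HS
    (Rgt_not_eq _ _ W1) (Rgt_not_eq _ _ W2)) as E.
  rewrite E0, Rmult_0_r in E.
  assert (cancel : forall u v : R, u <> 0 -> u * v = 0 -> v = 0).
  { intros u v Hu Huv. apply Rmult_integral in Huv. now destruct Huv. }
  assert (HJJ : 0 < J1 * J2) by now apply Rmult_lt_0_compat.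
  assert (HJS : 0 < J2 * (J1 + J2)) by (apply Rmult_lt_0_compat; lra).
  assert (Z1 : A * B - D ^ 2 = 0)
    by (apply (cancel ((J1 + J2) ^ 2)); [apply pow_nonzero |]; lra).
  assert (Z2 : D ^ 2 = 0) by (apply (cancel (4 * J1 * J2)); lra).
  assert (Z3 : (1 - A) * B = 0) by (apply (cancel (2 * J2 * (J1 + J2))); lra).
  assert (Z4 : P - B = 0).
  { apply (cancel (weight1 J1 J2 A)); [lra|].
    apply (cancel (J1 + J2)); lra. }
  repeat split; try lra.
  apply Rsqr_0_uniq. unfold Rsqr. lra.
Qed.

(** * Level sets *)

Definition centre (J1 J2 h P : R) : R := (P - 4 * J2 * h) / (4 * (J1 - J2) * h).

(** The constant ratios of A B - D^2 to w1 and of (1 - A)(P - B) - D^2 to w2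
    along the level set of (P, H, F) at (P, h, f); see [on_ellipse_slack]. The
    level set meets the reduced space only if both are nonnegative. *)
Definition slack1 (J1 J2 h P f : R) : R :=
  (f - 4 * h * (J1 + J2) * centre J1 J2 h P) / (J1 - J2).

Definition slack2 (J1 J2 h P f : R) : R :=
  slack1 J1 J2 h P f + (2 * (J1 + J2) * h - P) / (J1 - J2).

Definition on_ellipse (J1 J2 h P f A B D : R) : Prop :=
  B = f - 2 * (J1 + J2) * h * A /\
  D ^ 2 + 2 * h * (J1 + J2) * (A - centre J1 J2 h P) ^ 2
  = 2 * h * (J1 + J2) * centre J1 J2 h P ^ 2 - (J1 + J2) * slack1 J1 J2 h P f.

Lemma slack2_eq (J1 J2 h P f : R) :
  J1 <> J2 -> h <> 0 ->
  (J1 + J2) * slack2 J1 J2 h P f =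
  2 * h * (J1 + J2) - 4 * h * (J1 + J2) * centre J1 J2 h P
  + (J1 + J2) * slack1 J1 J2 h P f.
Proof.
  intros HJ Hh. unfold slack2, slack1, centre. field. split; lra.
Qed.

(** With B eliminated through F = f, the equation H = h is quadratic in A and
    D; its A^2 and D^2 coefficients are in the ratio 2 h S, and completing the
    square produces [centre]. *)
Lemma energy_eq_on_ellipse (J1 J2 h P f A B D : R) :
  0 < J1 -> 0 < J2 -> J1 <> J2 -> h <> 0 -> 0 <= A <= 1 ->
  (energy J1 J2 (point A B P D) = h /\
   2 * (J1 + J2) * A * h + B = f)
  <-> on_ellipse J1 J2 h P f A B D.
Proof.
  intros HJ1 HJ2 HJ Hh HA.
  destruct (weights_pos J1 J2 A HJ1 HJ2 HA) as [W1 W2].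
  assert (HS : 0 < J1 + J2) by lra.
  rewrite (energy_eq_iff J1 J2 A B P D h HS
    (Rgt_not_eq _ _ W1) (Rgt_not_eq _ _ W2)).
  assert (K : f = 2 * (J1 + J2) * A * h + B ->
    (J1 + J2) * (2 * h * weight1 J1 J2 A * weight2 J1 J2 A
                 + (J1 - J2) * B - P * weight1 J1 J2 A)
    + (J1 - J2) ^ 2 * D ^ 2 =
    (J1 - J2) ^ 2 *
    (D ^ 2 + 2 * h * (J1 + J2) * (A - centre J1 J2 h P) ^ 2
     - (2 * h * (J1 + J2) * centre J1 J2 h P ^ 2
        - (J1 + J2) * slack1 J1 J2 h P f))).
  { intros ->. unfold slack1, centre, weight1, weight2. field. split; lra. }
  unfold on_ellipse. split.
  - intros [E F]. split; [lra|].
    rewrite K in E by lra.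
    apply Rmult_integral in E. destruct E as [E|E]; [|lra].
    exfalso. apply (pow_nonzero (J1 - J2) 2); lra.
  - intros [F E]. split; [|lra]. rewrite K by lra.
    rewrite E. ring.
Qed.

(** Substituting B and D^2 makes both left-hand sides affine in A; the first
    turns out to vanish at the zero of w1, the second at the zero of w2. *)
Lemma on_ellipse_slack (J1 J2 h P f A B D : R) :
  J1 <> J2 -> h <> 0 -> on_ellipse J1 J2 h P f A B D ->
  A * B - D ^ 2 = slack1 J1 J2 h P f * weight1 J1 J2 A /\
  (1 - A) * (P - B) - D ^ 2 = slack2 J1 J2 h P f * weight2 J1 J2 A.
Proof.
  intros HJ Hh [-> E].
  assert (E' : D ^ 2 = 2 * h * (J1 + J2) * centre J1 J2 h P ^ 2
     - (J1 + J2) * slack1 J1 J2 h P f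
     - 2 * h * (J1 + J2) * (A - centre J1 J2 h P) ^ 2) by lra.
  rewrite E'. unfold slack2, slack1, centre, weight1, weight2.
  split; field; split; lra.
Qed.

(** The equation of the ellipse with the square expanded around A = 0 and
    around A = 1. When the slacks are nonnegative, these two forms confine the
    ellipse to 0 <= A <= 1. *)
Lemma on_ellipse_square (J1 J2 h P f A B D : R) :
  J1 <> J2 -> h <> 0 -> on_ellipse J1 J2 h P f A B D ->
  D ^ 2 + 2 * (h * (J1 + J2)) * (A * (A - 2 * centre J1 J2 h P))
    + (J1 + J2) * slack1 J1 J2 h P f = 0 /\
  D ^ 2 + 2 * (h * (J1 + J2))
          * ((1 - A) * (1 - A - 2 * (1 - centre J1 J2 h P)))
    + (J1 + J2) * slack2 J1 J2 h P f = 0.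
Proof.
  intros HJ Hh [_ E]. rewrite (slack2_eq J1 J2 h P f HJ Hh). split; lra.
Qed.

(** If the ellipse touches the boundary A = 0, the inequality D^2 <= A B says
    nothing about the sign of B. There D and the slack vanish, and the value
    of B follows. *)
Lemma on_ellipse_left_end (J1 J2 h P f B D : R) :
  J1 <> J2 -> 0 < J1 + J2 -> 0 < h -> 0 <= slack1 J1 J2 h P f ->
  on_ellipse J1 J2 h P f 0 B D ->
  B = 4 * (h * (J1 + J2)) * centre J1 J2 h P.
Proof.
  intros HJ HS Hh G Hell.
  destruct (on_ellipse_square J1 J2 h P f 0 B D HJ (Rgt_not_eq _ _ Hh) Hell)
    as [E _].
  destruct Hell as [-> _].
  assert (G' : 0 <= (J1 + J2) * slack1 J1 J2 h P f)
    by (apply Rmult_le_pos; lra).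
  pose proof (pow2_ge_0 D).
  assert (Z : (J1 + J2) * slack1 J1 J2 h P f = 0) by lra.
  apply Rmult_integral in Z. destruct Z as [Z|Z]; [lra|].
  replace f with ((J1 - J2) * slack1 J1 J2 h P f
                  + 4 * h * (J1 + J2) * centre J1 J2 h P)
    by (unfold slack1; field; lra).
  rewrite Z. ring.
Qed.

Lemma on_ellipse_right_end (J1 J2 h P f B D : R) :
  J1 <> J2 -> 0 < J1 + J2 -> 0 < h -> 0 <= slack2 J1 J2 h P f ->
  on_ellipse J1 J2 h P f 1 B D ->
  P - B = 4 * (h * (J1 + J2)) * (1 - centre J1 J2 h P).
Proof.
  intros HJ HS Hh G Hell.
  destruct (on_ellipse_square J1 J2 h P f 1 B D HJ (Rgt_not_eq _ _ Hh) Hell)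
    as [_ E].
  destruct Hell as [-> _].
  assert (G' : 0 <= (J1 + J2) * slack2 J1 J2 h P f)
    by (apply Rmult_le_pos; lra).
  pose proof (pow2_ge_0 D).
  assert (Z : (J1 + J2) * slack2 J1 J2 h P f = 0) by lra.
  apply Rmult_integral in Z. destruct Z as [Z|Z]; [lra|].
  replace f with ((J1 - J2) * slack2 J1 J2 h P f
                  + 4 * h * (J1 + J2) * centre J1 J2 h P
                  - (2 * (J1 + J2) * h - P))
    by (unfold slack2, slack1; field; lra).
  rewrite Z. ring.
Qed.

(** A centre left of 0 would force A = 0, since the terms of
    [on_ellipse_square] are nonnegative; then B would have the sign of the
    centre. The case of a centre right of 1 is symmetric, with P - B. *)
Lemma centre_bounds (J1 J2 h P f A B D : R) :
  J1 <> J2 -> 0 < J1 + J2 -> 0 < h ->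
  0 <= slack1 J1 J2 h P f -> 0 <= slack2 J1 J2 h P f ->
  on_ellipse J1 J2 h P f A B D -> 0 <= A <= 1 -> 0 <= B <= P ->
  0 <= centre J1 J2 h P <= 1.
Proof.
  intros HJ HS Hh G1 G2 Hell HA HB.
  assert (Hh0 : h <> 0) by lra.
  assert (HhS : 0 < h * (J1 + J2)) by (apply Rmult_lt_0_compat; lra).
  destruct (on_ellipse_square J1 J2 h P f A B D HJ Hh0 Hell) as [E1 E2].
  pose proof (on_ellipse_left_end J1 J2 h P f B D HJ HS Hh G1) as L.
  pose proof (on_ellipse_right_end J1 J2 h P f B D HJ HS Hh G2) as R.
  assert (G1' : 0 <= (J1 + J2) * slack1 J1 J2 h P f)
    by (apply Rmult_le_pos; lra).
  assert (G2' : 0 <= (J1 + J2) * slack2 J1 J2 h P f)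
    by (apply Rmult_le_pos; lra).
  pose proof (pow2_ge_0 D) as HD.
  split; apply Rnot_lt_le; intros Hc.
  - assert (A = 0) as ->; [|specialize (L Hell); nra].
    apply Rle_antisym; [|lra]. apply Rnot_lt_le; intros HA0.
    assert (0 < 2 * (h * (J1 + J2)) * (A * (A - 2 * centre J1 J2 h P)))
      by (repeat apply Rmult_lt_0_compat; lra).
    lra.
  - assert (A = 1) as ->; [|specialize (R Hell); nra].
    apply Rle_antisym; [lra|]. apply Rnot_lt_le; intros HA0.
    assert (0 < 2 * (h * (J1 + J2))
                * ((1 - A) * (1 - A - 2 * (1 - centre J1 J2 h P))))
      by (repeat apply Rmult_lt_0_compat; lra).
    lra.
Qed.

Lemma on_ellipse_range (J1 J2 h P f A B D : R) :
  J1 <> J2 -> 0 < J1 + J2 -> 0 < h -> 0 <= centre J1 J2 h P <= 1 ->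
  0 <= slack1 J1 J2 h P f -> 0 <= slack2 J1 J2 h P f ->
  on_ellipse J1 J2 h P f A B D -> 0 <= A <= 1.
Proof.
  intros HJ HS Hh Hc G1 G2 Hell.
  assert (HhS : 0 < h * (J1 + J2)) by (apply Rmult_lt_0_compat; lra).
  destruct (on_ellipse_square J1 J2 h P f A B D HJ (Rgt_not_eq _ _ Hh) Hell)
    as [E1 E2].
  assert (G1' : 0 <= (J1 + J2) * slack1 J1 J2 h P f)
    by (apply Rmult_le_pos; lra).
  assert (G2' : 0 <= (J1 + J2) * slack2 J1 J2 h P f)
    by (apply Rmult_le_pos; lra).
  pose proof (pow2_ge_0 D) as HD.
  split; apply Rnot_lt_le; intros HA.
  - assert (0 < 2 * (h * (J1 + J2)) * (A * (A - 2 * centre J1 J2 h P))).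
    { apply Rmult_lt_0_compat; [lra|].
      replace (A * (A - 2 * centre J1 J2 h P))
        with ((- A) * (2 * centre J1 J2 h P - A)) by ring.
      apply Rmult_lt_0_compat; lra. }
    lra.
  - assert (0 < 2 * (h * (J1 + J2))
                * ((1 - A) * (1 - A - 2 * (1 - centre J1 J2 h P)))).
    { apply Rmult_lt_0_compat; [lra|].
      replace ((1 - A) * (1 - A - 2 * (1 - centre J1 J2 h P)))
        with ((A - 1) * (A - 1 + 2 * (1 - centre J1 J2 h P))) by ring.
      apply Rmult_lt_0_compat; lra. }
    lra.
Qed.

(** The right-hand side constrains (A, B, D) only through the equation of the
    ellipse, so the reduced space contains the whole level set once it
    contains one of its points. This makes the flow complete. *)
Lemma level_set_iff (J1 J2 h P f A B D : R) :
  0 < J1 -> 0 < J2 -> J1 <> J2 -> 0 < h ->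
  (reduced_space (point A B P D) /\ energy J1 J2 (point A B P D) = h /\
   third_integral J1 J2 (point A B P D) = f) <->
  (0 <= centre J1 J2 h P <= 1 /\
   0 <= slack1 J1 J2 h P f /\ 0 <= slack2 J1 J2 h P f /\
   on_ellipse J1 J2 h P f A B D).
Proof.
  intros HJ1 HJ2 HJ Hh. assert (Hh0 : h <> 0) by lra.
  assert (HS : 0 < J1 + J2) by lra.
  change (third_integral J1 J2 (point A B P D))
    with (2 * (J1 + J2) * A * energy J1 J2 (point A B P D) + B).
  split.
  - intros [(HA & HB & H1 & H2) [E F]]. rewrite E in F.
    assert (Hell : on_ellipse J1 J2 h P f A B D)
      by (apply energy_eq_on_ellipse; auto).
    destruct (weights_pos J1 J2 A HJ1 HJ2 HA) as [W1 W2].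
    destruct (on_ellipse_slack J1 J2 h P f A B D HJ Hh0 Hell) as [E1 E2].
    assert (G1 : 0 <= slack1 J1 J2 h P f)
      by (apply (Rmult_le_reg_r _ _ _ W1); lra).
    assert (G2 : 0 <= slack2 J1 J2 h P f)
      by (apply (Rmult_le_reg_r _ _ _ W2); lra).
    split; [|now split].
    now apply (centre_bounds J1 J2 h P f A B D).
  - intros (Hc & G1 & G2 & Hell).
    assert (HA : 0 <= A <= 1)
      by now apply (on_ellipse_range J1 J2 h P f A B D).
    destruct (weights_pos J1 J2 A HJ1 HJ2 HA) as [W1 W2].
    destruct (on_ellipse_slack J1 J2 h P f A B D HJ Hh0 Hell) as [E1 E2].
    assert (K1 : 0 <= slack1 J1 J2 h P f * weight1 J1 J2 A)
      by (apply Rmult_le_pos; lra).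
    assert (K2 : 0 <= slack2 J1 J2 h P f * weight2 J1 J2 A)
      by (apply Rmult_le_pos; lra).
    pose proof (pow2_ge_0 D) as HD.
    assert (HhS : 0 < h * (J1 + J2)) by (apply Rmult_lt_0_compat; lra).
    assert (HB : 0 <= B <= P).
    { split.
      - destruct (Req_dec A 0) as [HA0|HA0].
        + rewrite HA0 in Hell.
          rewrite (on_ellipse_left_end J1 J2 h P f B D HJ HS Hh G1 Hell).
          apply Rmult_le_pos; lra.
        + apply (Rmult_le_reg_l A); lra.
      - apply Rminus_le_0. destruct (Req_dec A 1) as [HA1|HA1].
        + rewrite HA1 in Hell.
          rewrite (on_ellipse_right_end J1 J2 h P f B D HJ HS Hh G2 Hell).
          apply Rmult_le_pos; lra.
        + apply (Rmult_le_reg_l (1 - A)); lra. }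
    apply energy_eq_on_ellipse in Hell; [|assumption..].
    destruct Hell as [E F]. rewrite E.
    split; [|now split].
    change ((0 <= A <= 1) /\ (0 <= B <= P) /\ D ^ 2 <= A * B
            /\ D ^ 2 <= (1 - A) * (P - B)).
    repeat split; lra.
Qed.

(** * First integrals *)

Lemma point_coords (x : phase) :
  x = point (coord_A x) (coord_B x) (coord_P x) (coord_D x).
Proof. now destruct x as [[[A B] P] D]. Qed.

Lemma solution_coords (J1 J2 : R) (a b : Rbar) (c : R -> phase) (t : R) :
  solution (veselova_field J1 J2) reduced_space a b c -> in_interval a b t ->
  let h := energy J1 J2 (c t) in
  is_derive (fun s => coord_A (c s)) t (2 * coord_D (c t) / (J1 + J2)) /\
  is_derive (fun s => coord_B (c s)) t (- 4 * h * coord_D (c t)) /\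
  is_derive (fun s => coord_P (c s)) t 0 /\
  is_derive (fun s => coord_D (c s)) t
    (- 4 * h * coord_A (c t) + (coord_P (c t) - 4 * J2 * h) / (J1 - J2)).
Proof.
  intros Hc Ht h. destruct (Hc t Ht) as [_ Hd].
  apply is_derive_coords. revert Hd. unfold h.
  now destruct (c t) as [[[A B] P] D].
Qed.

Lemma momentum_first_integral (J1 J2 : R) :
  first_integral (veselova_field J1 J2) reduced_space momentum.
Proof.
  intros a b c Hc s t Hs Ht.
  assert (Hm : forall x, momentum x = coord_P x) by now intros [[[A B] P] D].
  rewrite !Hm.
  apply (derive_zero_constant a b (fun u => coord_P (c u))); [|assumption..].
  intros u Hu. apply (solution_coords J1 J2 a b c u Hc Hu).
Qed.

Lemma rational_energy_conserved (J1 J2 t h : R) (A B P D : R -> R) :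
  J1 <> J2 -> J1 + J2 <> 0 ->
  weight1 J1 J2 (A t) <> 0 -> weight2 J1 J2 (A t) <> 0 ->
  rational_energy J1 J2 (A t) (B t) (P t) (D t) = h ->
  is_derive A t (2 * D t / (J1 + J2)) ->
  is_derive B t (- 4 * h * D t) ->
  is_derive P t 0 ->
  is_derive D t (- 4 * h * A t + (P t - 4 * J2 * h) / (J1 - J2)) ->
  is_derive (fun s => rational_energy J1 J2 (A s) (B s) (P s) (D s)) t 0.
Proof.
  intros HJ HS W1 W2 Hh dA dB dP dD. revert Hh W1 W2.
  unfold rational_energy, weight1, weight2. intros Hh W1 W2.
  auto_derive.
  - repeat split; try (eexists; eassumption).
    apply Rmult_integral_contrapositive_currified; [lra|exact W2].
  - apply is_derive_unique in dA, dB, dP, dD.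
    (* the goal mentions these derivatives with domain R, not R_AbsRing *)
    change (Derive (fun s : R => A s) t = 2 * D t / (J1 + J2)) in dA.
    change (Derive (fun s : R => B s) t = - 4 * h * D t) in dB.
    change (Derive (fun s : R => P s) t = 0) in dP.
    change (Derive (fun s : R => D s) t
            = - 4 * h * A t + (P t - 4 * J2 * h) / (J1 - J2)) in dD.
    rewrite dA, dB, dP, dD, <- Hh.
    field. repeat split; try assumption; lra.
Qed.

Lemma energy_first_integral (J1 J2 : R) :
  0 < J1 -> 0 < J2 -> J1 <> J2 ->
  first_integral (veselova_field J1 J2) reduced_space (energy J1 J2).
Proof.
  intros HJ1 HJ2 HJ a b c Hc s t Hs Ht.
  assert (HW : forall u, in_interval a b u ->
    0 < weight1 J1 J2 (coord_A (c u)) /\ 0 < weight2 J1 J2 (coord_A (c u))).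
  { intros u Hu. destruct (Hc u Hu) as [HR _].
    rewrite (point_coords (c u)) in HR. destruct HR as [HA _].
    now apply weights_pos. }
  assert (HE : forall u, in_interval a b u -> energy J1 J2 (c u) =
    rational_energy J1 J2 (coord_A (c u)) (coord_B (c u)) (coord_P (c u))
      (coord_D (c u))).
  { intros u Hu. destruct (HW u Hu) as [W1 W2].
    rewrite (point_coords (c u)) at 1.
    apply energy_closed_form; lra. }
  rewrite (HE s Hs), (HE t Ht).
  apply (derive_zero_constant a b (fun u =>
    rational_energy J1 J2 (coord_A (c u)) (coord_B (c u)) (coord_P (c u))
      (coord_D (c u)))); [|assumption..].
  intros u Hu.
  destruct (solution_coords J1 J2 a b c u Hc Hu) as (dA & dB & dP & dD).
  destruct (HW u Hu) as [W1 W2].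
  apply (rational_energy_conserved J1 J2 u (energy J1 J2 (c u))
    (fun v => coord_A (c v)) (fun v => coord_B (c v))
    (fun v => coord_P (c v)) (fun v => coord_D (c v)));
    try assumption; try lra.
  symmetry. now apply HE.
Qed.

Lemma third_integral_coords (J1 J2 : R) (x : phase) :
  third_integral J1 J2 x
  = 2 * (J1 + J2) * coord_A x * energy J1 J2 x + coord_B x.
Proof. now destruct x as [[[A B] P] D]. Qed.

Lemma third_first_integral (J1 J2 : R) :
  0 < J1 -> 0 < J2 -> J1 <> J2 ->
  first_integral (veselova_field J1 J2) reduced_space (third_integral J1 J2).
Proof.
  intros HJ1 HJ2 HJ a b c Hc s t Hs Ht.
  pose proof (energy_first_integral J1 J2 HJ1 HJ2 HJ a b c Hc) as HE.
  rewrite !third_integral_coords, (HE t s Ht Hs).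
  set (h := energy J1 J2 (c s)) in *.
  enough (K : 2 * (J1 + J2) * h * coord_A (c s) + coord_B (c s)
              = 2 * (J1 + J2) * h * coord_A (c t) + coord_B (c t)) by lra.
  apply (derive_zero_constant a b (fun u =>
    2 * (J1 + J2) * h * coord_A (c u) + coord_B (c u))); [|assumption..].
  intros u Hu.
  destruct (solution_coords J1 J2 a b c u Hc Hu) as (dA & dB & _).
  rewrite (HE u s Hu Hs) in dB. fold h in dB.
  replace 0 with (2 * (J1 + J2) * h * (2 * coord_D (c u) / (J1 + J2))
                  + - 4 * h * coord_D (c u)) by (field; lra).
  apply (is_derive_plus (fun v => 2 * (J1 + J2) * h * coord_A (c v))
           (fun v => coord_B (c v))); [|exact dB].
  now apply (is_derive_scal (fun v => coord_A (c v))).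
Qed.

(** * Functional independence *)

(** The weights are positive on the reduced space; asking for it here yields
    an open set of the phase space on which H is smooth. *)
Definition regular_point (J1 J2 : R) (x : phase) : Prop :=
  coord_D x <> 0 /\
  0 < weight1 J1 J2 (coord_A x) /\ 0 < weight2 J1 J2 (coord_A x).

Lemma open_preimage_filterdiff (f lf : phase -> R) (O : R -> Prop) :
  (forall x, filterdiff f (locally x) lf) -> open O ->
  open (fun x => O (f x)).
Proof.
  intros Hf HO. apply open_comp; [|exact HO].
  intros x _. apply (filterdiff_continuous f x). now exists lf.
Qed.

Lemma open_regular_point (J1 J2 : R) : open (regular_point J1 J2).
Proof.
  assert (HA : forall x, filterdiff coord_A (locally x) coord_A)
    by (intros x; apply filterdiff_coords).
  assert (Hw : forall k : R, open (fun x => 0 < (J1 - J2) * coord_A x + k)).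
  { intros k.
    apply (open_preimage_filterdiff coord_A coord_A
             (fun r => 0 < (J1 - J2) * r + k) HA).
    apply (open_comp (fun r : R => (J1 - J2) * r + k) (fun r => 0 < r));
      [|apply open_gt].
    intros r _. apply (ex_derive_continuous (fun r : R => (J1 - J2) * r + k)).
    auto_derive. exact I. }
  apply open_and; [|apply open_and].
  - apply (open_preimage_filterdiff coord_D coord_D (fun r => r <> 0));
      [intros x; apply filterdiff_coords | apply open_neq].
  - apply (open_ext (fun x => 0 < (J1 - J2) * coord_A x + (J1 + J2))).
    + intros x. unfold weight1. split; lra.
    + apply Hw.
  - apply Hw.
Qed.

(** The independence of the integrals uses nothing about dH beyond its
    nonzero value on the D axis, so the rest of dH stays unspecified. *)
Lemma energy_filterdiff (J1 J2 : R) (x : phase) :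
  J1 <> J2 -> 0 < J1 + J2 -> regular_point J1 J2 x ->
  exists d : phase -> R,
    filterdiff (energy J1 J2) (locally x) d /\ d (point 0 0 0 1) <> 0.
Proof.
  intros HJ HS Hx.
  assert (Hd : exists d : phase -> R,
    filterdiff (fun y =>
      (coord_P y * ((J1 - J2) * coord_A y + (J1 + J2))
       + (J2 - J1) * coord_B y
       + (- ((J1 - J2) ^ 2 / (J1 + J2))) * (coord_D y * coord_D y))
      * / (2 * (((J1 - J2) * coord_A y + (J1 + J2))
                * ((J1 - J2) * coord_A y + 2 * J2))))
      (locally x) d /\ d (point 0 0 0 1) =
         - ((J1 - J2) ^ 2 / (J1 + J2)) * coord_D x
           / (weight1 J1 J2 (coord_A x) * weight2 J1 J2 (coord_A x))).
  { destruct (filterdiff_coords x) as (FA & FB & FP & FD). eexists. split.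
    - repeat (lazymatch goal with
        | |- filterdiff (fun y => @?f y * @?g y) _ _ => apply (filterdiff_Rmult f g)
        | |- filterdiff (fun y => @?f y + @?g y) _ _ => apply (filterdiff_Rplus f g)
        | |- filterdiff (fun y => / @?f y) _ _ => apply (filterdiff_Rinv f)
        | |- filterdiff (fun y => coord_A y) _ _ => exact FA
        | |- filterdiff (fun y => coord_B y) _ _ => exact FB
        | |- filterdiff (fun y => coord_P y) _ _ => exact FP
        | |- filterdiff (fun y => coord_D y) _ _ => exact FD
        | |- filterdiff (fun y => ?c) _ _ => apply (filterdiff_Rconst c) end).
      destruct Hx as (_ & W1 & W2). unfold weight1 in W1. unfold weight2 in W2.
      apply Rgt_not_eq. apply Rmult_lt_0_compat; [lra|].
      apply Rmult_lt_0_compat; lra.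
    - destruct Hx as (_ & W1 & W2). revert W1 W2.
      cbn. unfold weight1, weight2. intros W1 W2. field. repeat split; lra. }
  destruct Hd as (d & Hd & Ed). exists d. split.
  - revert Hd. apply filterdiff_ext_locally.
    apply (filter_imp (regular_point J1 J2)); [|now apply open_regular_point].
    intros y (_ & W1 & W2).
    replace (energy J1 J2 y) with
      (rational_energy J1 J2 (coord_A y) (coord_B y) (coord_P y) (coord_D y))
      by (rewrite <- energy_closed_form by lra; now rewrite <- point_coords).
    unfold rational_energy. revert W1 W2. unfold weight1, weight2.
    intros W1 W2. cbn. field. repeat split; lra.
  - rewrite Ed. destruct Hx as (HD & W1 & W2).
    assert (0 < weight1 J1 J2 (coord_A x) * weight2 J1 J2 (coord_A x))
      by now apply Rmult_lt_0_compat.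
    assert (0 < (J1 - J2) ^ 2) by (apply pow2_gt_0; lra).
    repeat apply Rmult_integral_contrapositive_currified; try assumption.
    + apply Ropp_neq_0_compat, Rgt_not_eq.
      now apply Rdiv_lt_0_compat.
    + apply Rinv_neq_0_compat. lra.
Qed.

(** Testing a vanishing combination on the D, B and P axes in turn is enough:
    along the D axis only dH and dF = 2 S (H dA + A dH) + dB contribute, which
    makes c2 = - 2 S A c3; then the B axis leaves c3 alone. *)
Lemma independent_at_regular_point (J1 J2 : R) (x : phase) :
  J1 <> J2 -> 0 < J1 + J2 -> regular_point J1 J2 x ->
  independent_at momentum (energy J1 J2) (third_integral J1 J2) x.
Proof.
  intros HJ HS Hx.
  destruct (energy_filterdiff J1 J2 x HJ HS Hx) as (d & Hd & Hd1).
  destruct (filterdiff_coords x) as (FA & FB & FP & FD).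
  set (h := energy J1 J2 x) in *.
  exists coord_P, d, (fun v =>
    (0 * coord_A x + 2 * (J1 + J2) * coord_A v) * h
    + 2 * (J1 + J2) * coord_A x * d v + coord_B v).
  split; [|split; [exact Hd|split]].
  - revert FP. apply filterdiff_ext. now intros [[[A B] P] D].
  - apply (filterdiff_ext (fun y =>
      2 * (J1 + J2) * coord_A y * energy J1 J2 y + coord_B y)).
    { intros y. symmetry. apply third_integral_coords. }
    apply filterdiff_Rplus; [|exact FB].
    apply (filterdiff_Rmult (fun y => 2 * (J1 + J2) * coord_A y)); [|exact Hd].
    apply (filterdiff_Rmult (fun _ => 2 * (J1 + J2))); [|exact FA].
    apply filterdiff_Rconst.
  - intros c1 c2 c3 Hc.
    pose proof (Hc (point 0 0 0 1)) as HD. cbn in HD.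
    assert (K : c2 = - (2 * (J1 + J2) * coord_A x * c3)).
    { apply Rminus_diag_uniq. apply (Rmult_eq_reg_r (d (point 0 0 0 1)));
        [|exact Hd1]. unfold point in *. lra. }
    pose proof (Hc (point 0 1 0 0)) as HB. cbn in HB.
    assert (K3 : c3 = 0).
    { rewrite K in HB. lra. }
    rewrite K3, Rmult_0_r, Ropp_0 in K.
    pose proof (Hc (point 0 0 1 0)) as HP. cbn in HP.
    rewrite K, K3 in HP. repeat split; lra.
Qed.

Lemma reduced_space_segment (A B P D A' B' P' D' e : R) :
  reduced_space (point A B P D) -> reduced_space (point A' B' P' D') ->
  0 <= e <= 1 ->
  reduced_space (point (A + e * (A' - A)) (B + e * (B' - B))
                       (P + e * (P' - P)) (D + e * (D' - D))).
Proof.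
  (* the cone b^2 <= a c, a, c >= 0 is convex *)
  assert (cone : forall a b c a' b' c' : R, 0 <= a -> 0 <= c -> 0 <= a' ->
    0 <= c' -> b ^ 2 <= a * c -> b' ^ 2 <= a' * c' -> 0 <= e <= 1 ->
    (b + e * (b' - b)) ^ 2 <= (a + e * (a' - a)) * (c + e * (c' - c))).
  { intros a b c a' b' c' Ha Hc Ha' Hc' H H' He.
    assert (M : 2 * (b * b') <= a * c' + a' * c).
    { apply Rsqr_incr_0_var.
      - assert (b ^ 2 * b' ^ 2 <= (a * c) * (a' * c'))
          by (apply Rmult_le_compat; try assumption; apply pow2_ge_0).
        pose proof (pow2_ge_0 (a * c' - a' * c)). unfold Rsqr. lra.
      - apply Rplus_le_le_0_compat; now apply Rmult_le_pos. }
    assert (0 <= (1 - e) ^ 2 * (a * c - b ^ 2))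
      by (apply Rmult_le_pos; [apply pow2_ge_0 | lra]).
    assert (0 <= e ^ 2 * (a' * c' - b' ^ 2))
      by (apply Rmult_le_pos; [apply pow2_ge_0 | lra]).
    assert (0 <= (e * (1 - e)) * (a * c' + a' * c - 2 * (b * b')))
      by (apply Rmult_le_pos; [apply Rmult_le_pos|]; lra).
    lra. }
  intros (HA & HB & H1 & H2) (HA' & HB' & H1' & H2') He.
  assert (mix : forall u v, 0 <= u -> 0 <= v -> 0 <= u + e * (v - u)).
  { intros u v Hu Hv.
    replace (u + e * (v - u)) with ((1 - e) * u + e * v) by ring.
    apply Rplus_le_le_0_compat; apply Rmult_le_pos; lra. }
  pose proof (mix A A') as M1. pose proof (mix (1 - A) (1 - A')) as M2.
  pose proof (mix B B') as M3. pose proof (mix (P - B) (P' - B')) as M4.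
  pose proof (cone A D B A' D' B') as C1.
  pose proof (cone (1 - A) D (P - B) (1 - A') D' (P' - B')) as C2.
  unfold point, reduced_space.
  replace (1 - (A + e * (A' - A)))
    with (1 - A + e * (1 - A' - (1 - A))) by ring.
  replace (P + e * (P' - P) - (B + e * (B' - B)))
    with (P - B + e * (P' - B' - (P - B))) by ring.
  repeat split; lra.
Qed.

(** Moving any point towards an interior point (1/2, 1/2, 1, d), with the sign
    of d chosen to agree with that of D, makes D nonzero at once. *)
Lemma regular_points_dense (J1 J2 : R) :
  0 < J1 -> 0 < J2 -> dense_in reduced_space (regular_point J1 J2).
Proof.
  intros HJ1 HJ2 [[[A B] P] D] HR N HN.
  assert (Hd : exists d : R, d ^ 2 <= 1 / 4 /\
                 forall e, 0 < e < 1 -> D + e * (d - D) <> 0).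
  { destruct (Rle_or_lt 0 D) as [HD|HD].
    - exists (1 / 2). split; [lra|]. intros e He. apply Rgt_not_eq.
      assert (0 <= (1 - e) * D) by (apply Rmult_le_pos; lra). lra.
    - exists (- (1 / 2)). split; [lra|]. intros e He. apply Rlt_not_eq.
      assert (0 <= (1 - e) * - D) by (apply Rmult_le_pos; lra). lra. }
  destruct Hd as (d & Hd & HD).
  assert (HZ : reduced_space (point (1 / 2) (1 / 2) 1 d)).
  { unfold point, reduced_space. lra. }
  set (c := fun e : R => point (A + e * (1 / 2 - A)) (B + e * (1 / 2 - B))
                               (P + e * (1 - P)) (D + e * (d - D))).
  assert (c0 : c 0 = (A, B, P, D)).
  { unfold c, point. now rewrite !Rmult_0_l, !Rplus_0_r. }
  assert (Cc : continuous c 0).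
  { apply ex_derive_continuous.
    exists (point (1 / 2 - A) (1 / 2 - B) (1 - P) (d - D)).
    apply is_derive_point; auto_derive; try exact I; ring. }
  assert (Hloc : locally 0 (fun e => N (c e))).
  { apply Cc. now rewrite c0. }
  destruct Hloc as [eps Heps].
  set (e := Rmin (eps / 2) (1 / 2)).
  assert (He : 0 < e < 1 /\ e < eps).
  { pose proof (cond_pos eps). unfold e.
    pose proof (Rmin_l (eps / 2) (1 / 2)).
    pose proof (Rmin_r (eps / 2) (1 / 2)).
    assert (0 < Rmin (eps / 2) (1 / 2)) by (apply Rmin_pos; lra). lra. }
  assert (Hce : reduced_space (c e))
    by (apply reduced_space_segment; try assumption; lra).
  exists (c e). split; [exact Hce|split].
  - split; [apply HD; lra|].
    apply weights_pos; [assumption..|]. apply Hce.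
  - apply Heps. change (Rabs (e - 0) < eps).
    rewrite Rminus_0_r, Rabs_pos_eq; lra.
Qed.

Lemma veselova_integrable (J1 J2 : R) :
  0 < J1 -> 0 < J2 -> J1 <> J2 ->
  integrable_with (veselova_field J1 J2) reduced_space
    momentum (energy J1 J2) (third_integral J1 J2).
Proof.
  intros HJ1 HJ2 HJ. split; [|split; [|split]].
  - apply momentum_first_integral.
  - now apply energy_first_integral.
  - now apply third_first_integral.
  - exists (regular_point J1 J2). split; [|split].
    + apply open_regular_point.
    + now apply regular_points_dense.
    + intros x _. apply independent_at_regular_point; lra.
Qed.

(** * Equilibria *)

Lemma veselova_field_point (J1 J2 A B P D h : R) :
  energy J1 J2 (point A B P D) = h ->
  veselova_field J1 J2 (point A B P D) =
  point (2 * D / (J1 + J2)) (- 4 * h * D) 0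
        (- 4 * h * A + (P - 4 * J2 * h) / (J1 - J2)).
Proof. now intros <-. Qed.

Lemma field_zero_iff (J1 J2 A B P D h : R) :
  J1 <> J2 -> 0 < J1 + J2 -> 0 < h -> energy J1 J2 (point A B P D) = h ->
  veselova_field J1 J2 (point A B P D) = zero <->
  A = centre J1 J2 h P /\ D = 0.
Proof.
  intros HJ HS Hh E.
  rewrite (veselova_field_point J1 J2 A B P D h E).
  assert (EA : - 4 * h * A + (P - 4 * J2 * h) / (J1 - J2)
               = - (4 * h) * (A - centre J1 J2 h P))
    by (unfold centre; field; split; lra).
  rewrite EA. split.
  - intros Z. change (zero : phase) with (point 0 0 0 0) in Z.
    injection Z as Z1 _ Z2. split.
    + apply Rminus_diag_uniq. apply (Rmult_eq_reg_l (- (4 * h))); lra.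
    + apply (Rmult_eq_reg_l (2 / (J1 + J2))).
      * rewrite Rmult_0_r, <- Z1. field. lra.
      * apply Rgt_not_eq. apply Rdiv_lt_0_compat; lra.
  - intros [-> ->]. change (zero : phase) with (point 0 0 0 0).
    unfold point. repeat f_equal; field; lra.
Qed.

Lemma zero_energy_equilibrium (J1 J2 : R) (x : phase) :
  0 < J1 -> 0 < J2 -> reduced_space x -> energy J1 J2 x = 0 ->
  equilibrium (veselova_field J1 J2) reduced_space x.
Proof.
  destruct x as [[[A B] P] D]. intros HJ1 HJ2 HR E. split; [exact HR|].
  destruct (energy_zero J1 J2 A B P D HJ1 HJ2 HR E) as (_ & HP & HD).
  change (A, B, P, D) with (point A B P D) in *.
  rewrite (veselova_field_point J1 J2 A B P D 0 E), HP, HD.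
  change (zero : phase) with (point 0 0 0 0).
  unfold point, Rdiv. repeat f_equal; ring.
Qed.

(** At the equilibrium the slacks are 2 h A0^2 and 2 h (1 - A0)^2, the largest
    slacks for which the ellipse is nonempty, so that it shrinks to its
    centre. [level_set_iff] places the equilibrium in the reduced space, given
    only that A0 lies in [0, 1], which any point with these values of P and H
    guarantees. *)
Lemma unique_equilibrium (J1 J2 h P : R) :
  0 < J1 -> 0 < J2 -> J1 <> J2 -> 0 < h -> energy_momentum_image J1 J2 P h ->
  unique
    (fun x : phase =>
       equilibrium (veselova_field J1 J2) reduced_space x /\
       energy J1 J2 x = h /\ momentum x = P)
    (point (centre J1 J2 h P)
       ((P - 4 * J2 * h) * (P + 4 * J1 * h) / (8 * (J1 - J2) * h)) P 0).
Proof.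
  intros HJ1 HJ2 HJ Hh ([[[A B] P'] D] & HR & HP & HE).
  cbn in HP. subst P'. change (A, B, P, D) with (point A B P D) in *.
  destruct (proj1 (level_set_iff J1 J2 h P
                    (third_integral J1 J2 (point A B P D)) A B D
                    HJ1 HJ2 HJ Hh)) as [Hc _]; [now split|].
  assert (HS : 0 < J1 + J2) by lra.
  set (B0 := (P - 4 * J2 * h) * (P + 4 * J1 * h) / (8 * (J1 - J2) * h)).
  set (f0 := 2 * (J1 + J2) * h * centre J1 J2 h P + B0).
  assert (G1 : slack1 J1 J2 h P f0 = 2 * h * centre J1 J2 h P ^ 2).
  { unfold slack1, f0, B0, centre. field. split; lra. }
  assert (G2 : slack2 J1 J2 h P f0 = 2 * h * (1 - centre J1 J2 h P) ^ 2).
  { unfold slack2. rewrite G1. unfold centre. field. split; lra. }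
  split.
  - destruct (proj2 (level_set_iff J1 J2 h P f0 (centre J1 J2 h P) B0 0
                      HJ1 HJ2 HJ Hh)) as (HR0 & E0 & _).
    { rewrite G1, G2. split; [exact Hc|split; [|split; [|split]]].
      - apply Rmult_le_pos; [lra | apply pow2_ge_0].
      - apply Rmult_le_pos; [lra | apply pow2_ge_0].
      - unfold f0. ring.
      - rewrite G1. ring. }
    split; [|now split]. split; [exact HR0|].
    now apply (field_zero_iff J1 J2 _ _ _ _ h).
  - intros [[[A1 B1] P1] D1] [[HR1 Z1] [E1 HP1]].
    cbn in HP1. subst P1. change (A1, B1, P, D1) with (point A1 B1 P D1) in *.
    apply (field_zero_iff J1 J2 _ _ _ _ h HJ HS Hh E1) in Z1.
    destruct Z1 as [-> ->]. f_equal.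
    destruct HR1 as [HA1 _].
    destruct (proj1 (energy_eq_on_ellipse J1 J2 h P _ _ B1 0 HJ1 HJ2 HJ
                      (Rgt_not_eq _ _ Hh) HA1) (conj E1 eq_refl)) as [_ K].
    set (f1 := 2 * (J1 + J2) * centre J1 J2 h P * h + B1) in K.
    (* at the centre of its own ellipse, the point determines the slack, hence
       the value of F, hence B *)
    assert (K1 : slack1 J1 J2 h P f1 = slack1 J1 J2 h P f0).
    { rewrite G1. apply (Rmult_eq_reg_l (J1 + J2)); [|lra]. lra. }
    unfold slack1 in K1. unfold Rdiv in K1.
    apply Rmult_eq_reg_r in K1; [|apply Rinv_neq_0_compat; lra].
    unfold f1, f0 in K1. lra.
Qed.

(** * The flow *)

(** The rotation of the ellipse through the point with coordinates A and D at
    time t0; 2 / k is the angular speed sqrt (8 h / (J1 + J2)). *)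
Definition orbit (J1 J2 h P f A D t0 t : R) : phase :=
  let c := centre J1 J2 h P in
  let k := sqrt ((J1 + J2) / (2 * h)) in
  let th := 2 * (t - t0) / k in
  let At := c + (A - c) * cos th + k / (J1 + J2) * D * sin th in
  let Dt := D * cos th - (J1 + J2) / k * (A - c) * sin th in
  point At (f - 2 * (J1 + J2) * h * At) P Dt.

Lemma sqrt_ratio (S h : R) :
  0 < S -> 0 < h ->
  0 < sqrt (S / (2 * h)) /\ S = 2 * h * sqrt (S / (2 * h)) ^ 2.
Proof.
  intros HS Hh.
  assert (H : 0 < S / (2 * h)) by (apply Rdiv_lt_0_compat; lra).
  split; [now apply sqrt_lt_R0|].
  rewrite pow2_sqrt by lra. field. lra.
Qed.

Lemma orbit_on_ellipse (J1 J2 h P f A B D t0 t : R) :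
  0 < J1 + J2 -> 0 < h -> on_ellipse J1 J2 h P f A B D ->
  let x := orbit J1 J2 h P f A D t0 t in
  on_ellipse J1 J2 h P f (coord_A x) (coord_B x) (coord_D x).
Proof.
  intros HS Hh [_ E]. destruct (sqrt_ratio _ _ HS Hh) as [Hk HSk].
  unfold orbit, coord_A, coord_B, coord_D, point. cbn [fst snd].
  revert E Hk HSk. unfold on_ellipse.
  generalize (sqrt ((J1 + J2) / (2 * h))) as k,
    (slack1 J1 J2 h P f) as g, (centre J1 J2 h P) as c.
  intros k g c E Hk HSk.
  generalize (2 * (t - t0) / k) as th. intros th.
  split; [reflexivity|]. rewrite <- E.
  pose proof (sin2_cos2 th) as HT. unfold Rsqr in HT.
  assert (H2 : 2 * h = (J1 + J2) / k ^ 2) by (rewrite HSk; field; lra).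
  rewrite H2.
  transitivity ((D ^ 2 + (J1 + J2) / k ^ 2 * (J1 + J2) * (A - c) ^ 2)
                * (sin th * sin th + cos th * cos th)).
  - field. split; lra.
  - rewrite HT. ring.
Qed.

Lemma orbit_solution (J1 J2 h P f A B D t0 : R) :
  0 < J1 -> 0 < J2 -> J1 <> J2 -> 0 < h ->
  reduced_space (point A B P D) -> energy J1 J2 (point A B P D) = h ->
  third_integral J1 J2 (point A B P D) = f ->
  solution (veselova_field J1 J2) reduced_space m_infty p_infty
    (orbit J1 J2 h P f A D t0).
Proof.
  intros HJ1 HJ2 HJ Hh HR HE HF t _.
  assert (HS : 0 < J1 + J2) by lra.
  destruct (proj1 (level_set_iff J1 J2 h P f A B D HJ1 HJ2 HJ Hh))
    as (Hc & G1 & G2 & Hell); [now split|].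
  pose proof (orbit_on_ellipse J1 J2 h P f A B D t0 t HS Hh Hell) as Hx.
  cbv zeta in Hx.
  destruct (proj2 (level_set_iff J1 J2 h P f
      (coord_A (orbit J1 J2 h P f A D t0 t))
      (coord_B (orbit J1 J2 h P f A D t0 t))
      (coord_D (orbit J1 J2 h P f A D t0 t)) HJ1 HJ2 HJ Hh))
    as (HRt & HEt & _); [now split|].
  split; [exact HRt|].
  set (x := orbit J1 J2 h P f A D t0 t) in *.
  assert (EX : veselova_field J1 J2 x =
    point (2 * coord_D x / (J1 + J2)) (- 4 * h * coord_D x) 0
          (- 4 * h * coord_A x + (P - 4 * J2 * h) / (J1 - J2)))
    by exact (veselova_field_point J1 J2 _ _ P _ h HEt).
  rewrite EX. clear HRt HEt Hx EX. unfold x.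
  destruct (sqrt_ratio _ _ HS Hh) as [Hk HSk].
  unfold orbit, coord_A, coord_D, point. cbn [fst snd].
  assert (Hcc : (P - 4 * J2 * h) / (J1 - J2) = 4 * h * centre J1 J2 h P)
    by (unfold centre; field; split; lra).
  rewrite Hcc.
  revert Hk HSk.
  generalize (sqrt ((J1 + J2) / (2 * h))) as k, (centre J1 J2 h P) as c.
  intros k c Hk HSk.
  assert (H2 : h = (J1 + J2) / (2 * k ^ 2)) by (rewrite HSk; field; lra).
  apply is_derive_point; auto_derive; try exact I; try ring.
  all: change (2 * (t + - t0) * / k) with (2 * (t - t0) / k).
  all: try rewrite H2; field; lra.
Qed.

(** The difference of two solutions solves the homogeneous system, whose
    energy D^2 + 2 S h A^2 is definite and conserved. *)
Lemma linear_system_unique (S h t0 : R) (a b : Rbar) (A A' D D' : R -> R) (k : R) :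
  0 < S -> 0 < h -> in_interval a b t0 ->
  (forall t, in_interval a b t ->
    is_derive A t (2 * D t / S) /\ is_derive A' t (2 * D' t / S) /\
    is_derive D t (- 4 * h * A t + k) /\
    is_derive D' t (- 4 * h * A' t + k)) ->
  A t0 = A' t0 -> D t0 = D' t0 ->
  forall t, in_interval a b t -> A t = A' t /\ D t = D' t.
Proof.
  intros HS Hh Ht0 Hd HA HD t Ht.
  assert (K : (D t - D' t) ^ 2 + 2 * S * h * (A t - A' t) ^ 2
              = (D t0 - D' t0) ^ 2 + 2 * S * h * (A t0 - A' t0) ^ 2).
  { apply (derive_zero_constant a b (fun u =>
      (D u - D' u) ^ 2 + 2 * S * h * (A u - A' u) ^ 2)); [|assumption..].
    intros u Hu. destruct (Hd u Hu) as (dA & dA' & dD & dD').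
    auto_derive.
    - repeat split; eexists; eassumption.
    - apply is_derive_unique in dA, dA', dD, dD'.
      (* the goal mentions these derivatives with domain R, not R_AbsRing *)
      change (Derive (fun s : R => A s) u = 2 * D u / S) in dA.
      change (Derive (fun s : R => A' s) u = 2 * D' u / S) in dA'.
      change (Derive (fun s : R => D s) u = - 4 * h * A u + k) in dD.
      change (Derive (fun s : R => D' s) u = - 4 * h * A' u + k) in dD'.
      rewrite dA, dA', dD, dD'. field. lra. }
  rewrite HA, HD, !Rminus_diag in K.
  assert (HSh : 0 < 2 * S * h) by (repeat apply Rmult_lt_0_compat; lra).
  pose proof (pow2_ge_0 (D t - D' t)) as P1.
  pose proof (pow2_ge_0 (A t - A' t)) as P2.
  assert (P3 : 0 <= 2 * S * h * (A t - A' t) ^ 2)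
    by (apply Rmult_le_pos; lra).
  split; apply Rminus_diag_uniq, Rsqr_0_uniq; unfold Rsqr.
  - apply (Rmult_eq_reg_l (2 * S * h)); lra.
  - lra.
Qed.

(** Along both solutions H and P keep their common initial values, so that A
    and D solve the same linear system; F then recovers B. *)
Lemma solutions_agree (J1 J2 t0 : R) (a b : Rbar) (c c' : R -> phase) :
  0 < J1 -> 0 < J2 -> J1 <> J2 ->
  solution (veselova_field J1 J2) reduced_space a b c ->
  solution (veselova_field J1 J2) reduced_space a b c' ->
  in_interval a b t0 -> 0 < energy J1 J2 (c t0) -> c t0 = c' t0 ->
  forall t, in_interval a b t -> c t = c' t.
Proof.
  intros HJ1 HJ2 HJ Hc Hc' Ht0 Hh E0 t Ht.
  set (h := energy J1 J2 (c t0)) in *. set (P := momentum (c t0)).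
  assert (Hm : forall x, momentum x = coord_P x) by now intros [[[A B] P'] D].
  assert (HE : forall u, in_interval a b u -> energy J1 J2 (c u) = h)
    by (intros u Hu; now apply (energy_first_integral J1 J2 HJ1 HJ2 HJ a b)).
  assert (HE' : forall u, in_interval a b u -> energy J1 J2 (c' u) = h).
  { intros u Hu. unfold h. rewrite E0.
    now apply (energy_first_integral J1 J2 HJ1 HJ2 HJ a b). }
  assert (HP : forall u, in_interval a b u -> coord_P (c u) = P).
  { intros u Hu. rewrite <- Hm.
    now apply (momentum_first_integral J1 J2 a b). }
  assert (HP' : forall u, in_interval a b u -> coord_P (c' u) = P).
  { intros u Hu. rewrite <- Hm. unfold P. rewrite E0.
    now apply (momentum_first_integral J1 J2 a b). }
  destruct (linear_system_unique (J1 + J2) h t0 a b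
    (fun u => coord_A (c u)) (fun u => coord_A (c' u))
    (fun u => coord_D (c u)) (fun u => coord_D (c' u))
    ((P - 4 * J2 * h) / (J1 - J2))) with (t := t) as [EA ED];
    try assumption; try lra.
  - intros u Hu.
    destruct (solution_coords J1 J2 a b c u Hc Hu) as (dA & _ & _ & dD).
    destruct (solution_coords J1 J2 a b c' u Hc' Hu) as (dA' & _ & _ & dD').
    rewrite (HE u Hu), (HP u Hu) in dD. rewrite (HE' u Hu), (HP' u Hu) in dD'.
    now split.
  - now rewrite E0.
  - now rewrite E0.
  - assert (F : third_integral J1 J2 (c t) = third_integral J1 J2 (c' t)).
    { rewrite (third_first_integral J1 J2 HJ1 HJ2 HJ a b c Hc t t0 Ht Ht0).
      rewrite (third_first_integral J1 J2 HJ1 HJ2 HJ a b c' Hc' t t0 Ht Ht0).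
      now rewrite E0. }
    rewrite !third_integral_coords, (HE t Ht), (HE' t Ht), EA in F.
    rewrite (point_coords (c t)), (point_coords (c' t)).
    rewrite EA, ED, (HP t Ht), (HP' t Ht). f_equal. lra.
Qed.

Lemma orbit_start (J1 J2 h P f A B D t0 : R) :
  f = 2 * (J1 + J2) * A * h + B ->
  orbit J1 J2 h P f A D t0 t0 = point A B P D.
Proof.
  intros ->. unfold orbit.
  replace (2 * (t0 - t0) / sqrt ((J1 + J2) / (2 * h))) with 0
    by (unfold Rdiv; ring).
  rewrite cos_0, sin_0. unfold point. repeat f_equal; ring.
Qed.

(** A nontrivial rotation of the plane fixes only the origin; this makes the
    period minimal. *)
Lemma rotation_fixes (u v th : R) :
  u * cos th + v * sin th = u -> v * cos th - u * sin th = v ->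
  0 < th < 2 * PI -> u = 0 /\ v = 0.
Proof.
  intros H1 H2 Hth.
  assert (Hs : 0 < sin (th / 2)) by (apply sin_gt_0; lra).
  assert (Hcos : cos th = 1 - 2 * sin (th / 2) * sin (th / 2)).
  { rewrite <- cos_2a_sin. f_equal. lra. }
  assert (K : (u ^ 2 + v ^ 2) * (1 - cos th) = 0).
  { transitivity (u * (u - (u * cos th + v * sin th))
                  + v * (v - (v * cos th - u * sin th))); [ring|].
    rewrite H1, H2. ring. }
  rewrite Hcos in K.
  assert (0 < sin (th / 2) * sin (th / 2)) by now apply Rmult_lt_0_compat.
  apply Rmult_integral in K. destruct K as [K|K]; [|lra].
  pose proof (pow2_ge_0 u). pose proof (pow2_ge_0 v).
  split; apply Rsqr_0_uniq; unfold Rsqr; lra.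
Qed.

Lemma orbit_period (J1 J2 h P f A D t0 : R) :
  0 < J1 + J2 -> 0 < h -> ~ (A = centre J1 J2 h P /\ D = 0) ->
  periodic_with_period (orbit J1 J2 h P f A D t0)
    (PI * sqrt ((J1 + J2) / (2 * h))).
Proof.
  intros HS Hh Hne. destruct (sqrt_ratio _ _ HS Hh) as [Hk _].
  pose proof PI_RGT_0 as HPI. unfold orbit.
  revert Hne Hk. generalize (sqrt ((J1 + J2) / (2 * h))) as k.
  generalize (centre J1 J2 h P) as c. intros c k Hne Hk. cbv zeta.
  split; [split|].
  - now apply Rmult_lt_0_compat.
  - intros t.
    replace (2 * (t + PI * k - t0) / k) with (2 * (t - t0) / k + 2 * PI)
      by (field; lra).
    now rewrite cos_plus, sin_plus, cos_2PI, sin_2PI, !Rmult_0_r, !Rmult_1_r,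
      Rminus_0_r, Rplus_0_r.
  - intros T [HT HTp]. apply Rnot_lt_le. intros Hlt.
    specialize (HTp t0).
    replace (2 * (t0 + T - t0) / k) with (2 * T / k) in HTp
      by (field; lra).
    replace (2 * (t0 - t0) / k) with 0 in HTp by (field; lra).
    rewrite cos_0, sin_0 in HTp. unfold point in HTp.
    injection HTp as EA _ ED.
    (* k D / S is the scaling of D that turns the ellipse into a circle *)
    destruct (rotation_fixes (A - c) (k / (J1 + J2) * D) (2 * T / k))
      as [Zu Zv].
    + lra.
    + transitivity (k / (J1 + J2) * (D * cos (2 * T / k)
                    - (J1 + J2) / k * (A - c) * sin (2 * T / k)));
        [field; lra|]. rewrite ED. ring.
    + split.
      * apply Rdiv_lt_0_compat; lra.
      * apply (Rmult_lt_reg_r k); [exact Hk|].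
        replace (2 * T / k * k) with (2 * T) by (field; lra). lra.
    + apply Hne. split; [lra|].
      apply (Rmult_eq_reg_l (k / (J1 + J2))); [lra|].
      apply Rgt_not_eq, Rdiv_lt_0_compat; lra.
Qed.

(** For h = 0 the rotation degenerates, but the point is then an
    equilibrium. *)
Lemma global_solution (J1 J2 : R) (x : phase) :
  0 < J1 -> 0 < J2 -> J1 <> J2 -> reduced_space x ->
  exists gamma : R -> phase,
    solution (veselova_field J1 J2) reduced_space m_infty p_infty gamma /\
    gamma 0 = x.
Proof.
  intros HJ1 HJ2 HJ HR.
  destruct (energy_nonneg J1 J2 x HJ1 HJ2 HR) as [Hh|Hh].
  - destruct x as [[[A B] P] D]. change (A, B, P, D) with (point A B P D) in *.
    set (h := energy J1 J2 (point A B P D)) in *.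
    exists (orbit J1 J2 h P (third_integral J1 J2 (point A B P D)) A D 0).
    split.
    + now apply (orbit_solution J1 J2 h P _ A B D 0).
    + now apply orbit_start.
  - exists (fun _ => x). split; [|reflexivity].
    intros t _. split; [exact HR|].
    destruct (zero_energy_equilibrium J1 J2 x HJ1 HJ2 HR (eq_sym Hh))
      as [_ Z].
    rewrite Z. apply (is_derive_const (V := phase) x).
Qed.

Lemma nonequilibrium_periodic (J1 J2 : R) (a b : Rbar) (sigma : R -> phase)
    (t0 : R) :
  0 < J1 -> 0 < J2 -> J1 <> J2 ->
  solution (veselova_field J1 J2) reduced_space a b sigma ->
  in_interval a b t0 ->
  ~ equilibrium (veselova_field J1 J2) reduced_space (sigma t0) ->
  exists gamma : R -> phase,
    solution (veselova_field J1 J2) reduced_space m_infty p_infty gamma /\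
    (forall t, in_interval a b t -> gamma t = sigma t) /\
    periodic_with_period gamma
      (PI * sqrt ((J1 + J2) / (2 * energy J1 J2 (sigma t0)))).
Proof.
  intros HJ1 HJ2 HJ Hs Ht0 Hne.
  destruct (Hs t0 Ht0) as [HR _].
  destruct (energy_nonneg J1 J2 (sigma t0) HJ1 HJ2 HR) as [Hh|Hh];
    [|now contradict Hne; apply zero_energy_equilibrium].
  pose proof (point_coords (sigma t0)) as Ex.
  revert Ex. generalize (coord_A (sigma t0)) as A, (coord_B (sigma t0)) as B,
    (coord_P (sigma t0)) as P, (coord_D (sigma t0)) as D.
  intros A B P D Ex. rewrite Ex in HR, Hh, Hne |- *.
  set (h := energy J1 J2 (point A B P D)) in *.
  set (f := third_integral J1 J2 (point A B P D)).
  assert (Hsol : solution (veselova_field J1 J2) reduced_space m_infty p_infty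
                   (orbit J1 J2 h P f A D t0))
    by now apply (orbit_solution J1 J2 h P f A B D t0).
  assert (Hstart : orbit J1 J2 h P f A D t0 t0 = point A B P D)
    by now apply orbit_start.
  exists (orbit J1 J2 h P f A D t0). split; [exact Hsol|split].
  - apply (solutions_agree J1 J2 t0 a b); try assumption.
    + intros t _. now apply Hsol.
    + now rewrite Hstart.
    + now rewrite Hstart, Ex.
  - apply orbit_period; [lra|exact Hh|].
    intros Hcd. apply Hne. split; [exact HR|].
    apply (field_zero_iff J1 J2 A B P D h); try assumption; lra || reflexivity.
Qed.

(** * The dynamics of the reduced top *)

Theorem theorem5p4 (J1 J2 : R) (hJ1 : 0 < J1) (hJ2 : 0 < J2) (hJ : J1 <> J2) :
  (* (i) *)
  integrable_with (veselova_field J1 J2) reduced_space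
    momentum (energy J1 J2) (third_integral J1 J2) /\
  (* (ii) *)
  (forall x : phase, reduced_space x -> energy J1 J2 x = 0 ->
    equilibrium (veselova_field J1 J2) reduced_space x) /\
  (* (iii) *)
  (forall h P : R, 0 < h -> energy_momentum_image J1 J2 P h ->
    unique
      (fun x : phase =>
        equilibrium (veselova_field J1 J2) reduced_space x /\
        energy J1 J2 x = h /\ momentum x = P)
      (point ((P - 4 * J2 * h) / (4 * (J1 - J2) * h))
             ((P - 4 * J2 * h) * (P + 4 * J1 * h) / (8 * (J1 - J2) * h))
             P
             0)) /\
  (* (iv): every point of the reduced space lies on a solution defined for all
     times, and every solution, over any open interval, that is not an
     equilibrium extends to a periodic one *)
  (forall x : phase, reduced_space x ->
    exists gamma : R -> phase,
      solution (veselova_field J1 J2) reduced_space m_infty p_infty gamma /\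
      gamma 0 = x) /\
  (forall (a b : Rbar) (sigma : R -> phase) (t0 : R),
    solution (veselova_field J1 J2) reduced_space a b sigma ->
    in_interval a b t0 ->
    ~ equilibrium (veselova_field J1 J2) reduced_space (sigma t0) ->
    exists gamma : R -> phase,
      solution (veselova_field J1 J2) reduced_space m_infty p_infty gamma /\
      (forall t, in_interval a b t -> gamma t = sigma t) /\
      periodic_with_period gamma
        (PI * sqrt ((J1 + J2) / (2 * energy J1 J2 (sigma t0))))).
Proof.
  split; [|split; [|split; [|split]]].
  - now apply veselova_integrable.
  - intros x. now apply zero_energy_equilibrium.
  - intros h P. now apply unique_equilibrium.
  - intros x. now apply global_solution.
  - intros a b sigma t0. now apply nonequilibrium_periodic.
Qed.
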